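(* Let $s\geq0$ be an integer. For all integers $0\leq r\leq k\leq n$, the modified partial Bell polynomial satisfies $$\widetilde{\mathcal{B}}_{n,k,r}^{(s)}(y_{1},\ldots,y_{s+n-k+1})=\sum_{p=r}^{n-k+r}\binom{n}{p}\mathcal{B}_{n-p,k-r}(y_{1},\ldots,y_{n-p-k+r+1})\,\mathcal{B}_{p,r}(y_{s+1},\ldots,y_{s+p-r+1}).$$ For every integer $n\geq0$, the modified complete Bell polynomial satisfies $$\widetilde{\mathcal{B}}_{n}^{(s)}(y_{1},\ldots,y_{s+n})=\sum_{p=0}^{n}\binom{n}{p}\mathcal{B}_{n-p}(y_{1},\ldots,y_{n-p})\,\mathcal{B}_{p}(y_{s+1},\ldots,y_{s+p}).$$
   Context: A partition $\lambda$ is a finite weakly decreasing sequence of positive integers $a_1,\dots,a_L$ (the empty partition is allowed), with length $\ell(\lambda)=L$ and $|\lambda|=\sum_l a_l$; $\lambda\vdash N$ means $|\lambda|=N$. For $i\geq1$, $m_i=m_i(\lambda)$ is the number of indices $l$ with $a_l=i$. For $s\geq0$, $\lambda^{>s}$ is the partition obtained by deleting all parts $a_l\leq s$; $(a)_s=\prod_{\upsilon=0}^{s-1}(a-\upsilon)$; $(\mu)_s$ is the sequence obtained by replacing each part $a_l$ of a partition $\mu$ by $(a_l)_s$. $e_r$ of a finite sequence is the $r$th elementary symmetric function of its entries ($e_0=1$; $e_r=0$ if there are fewer than $r$ entries). Partial Bell polynomials, for $n,k\ge 0$: $$\mathcal{B}_{n,k}(y_{1},\ldots,y_{n-k+1})=\sum_{\substack{\lambda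 \vdash n \\ \ell(\lambda)=k}}\frac{n!}{\prod_{i\geq1}(i!)^{m_{i}}m_{i}!}\prod_{i\geq1}y_{i}^{m_{i}},$$ so $\mathcal{B}_{0,0}=1$. Complete Bell polynomials: $\mathcal{B}_{n}(y_1,\dots,y_n)=\sum_{k=0}^{n}\mathcal{B}_{n,k}$, so $\mathcal{B}_0=1$. An expression such as $\mathcal{B}_{p,r}(y_{s+1},\ldots,y_{s+p-r+1})$ means that the $i$th variable is replaced by $y_{s+i}$. Modified partial Bell polynomials: $$\widetilde{\mathcal{B}}_{n,k,r}^{(s)}(y_{1},\ldots,y_{s+n-k+1})=\sum_{\substack{\lambda \vdash n+rs \\ \ell(\lambda)=k \\ \ell(\lambda^{>s}) \geq r}}\frac{n!\,e_{r}\big((\lambda^{>s})_{s}\big)}{\prod_{i\geq1}(i!)^{m_{i}}m_{i}!}\prod_{i\geq1}y_{i}^{m_{i}}$$ (only variables $y_i$ with $i\leq s+n-k+1$ occur). Modified complete Bell polynomials: $\widetilde{\mathcal{B}}_{n}^{(s)}(y_1,\dots,y_{s+n})=\sum_{r=0}^{n}\sum_{k=r}^{n}\widetilde{\mathcal{B}}_{n,k,r}^{(s)}$. *)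

(* Defs.v *)
From mathcomp Require Import all_boot all_order all_algebra.
From mathcomp Require Export mpoly.
Set Implicit Arguments.
Unset Strict Implicit.
Unset Printing Implicit Defensive.
Import GRing.Theory.
Local Open Scope ring_scope.

Definition is_part (N : nat) (l : seq nat) : bool :=
  [&& sorted geq l, 0%N \notin l & sumn l == N].

(* A partition of N has at most N parts, each at most N, so that this list
   contains each of them exactly once (mem_partitions, uniq_partitions). *)
Definition partitions (N : nat) : seq (seq nat) :=
  [seq l <- [seq map val (val b) | b <- enum {: N.-bseq 'I_N.+1}] | is_part N l].

Lemma mem_partitions N l : (l \in partitions N) = is_part N l.
Proof.
rewrite mem_filter; case: (boolP (is_part N l)) => //= /and3P [_ l0 /eqP lN].
have le_sumn a : a \in l -> (a <= N)%N.
  by move=> al; rewrite -lN sumnE (big_rem a al) leq_addr.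
have size_l : (size l <= N)%N.
  rewrite -lN; elim: (l) l0 => //= a m IH; rewrite inE negb_or => /andP [a0 m0].
  by rewrite -add1n leq_add ?IH // lt0n eq_sym.
have size_b : (size (map (@inord N) l) <= N)%N by rewrite size_map.
apply/mapP; exists (Bseq size_b); first by rewrite mem_enum.
rewrite /= -map_comp -[LHS]map_id; apply/eq_in_map => a al /=.
by rewrite inordK // ltnS le_sumn.
Qed.

Lemma uniq_partitions N : uniq (partitions N).
Proof.
rewrite filter_uniq // map_inj_uniq ?enum_uniq //.
by move=> b c /(inj_map val_inj) /val_inj.
Qed.

Definition mult (i : nat) (l : seq nat) : nat := count_mem i l.

Definition parts_gt (s : nat) (l : seq nat) : seq nat := [seq a <- l | s < a]%N.

Definition ffact_parts (s : nat) (l : seq nat) : seq nat := [seq a ^_ s | a <- l]%N.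

Definition esym (r : nat) (l : seq nat) : rat :=
  (mesym (size l) rat r).@[fun i => (tnth (in_tuple l) i)%:R].

(* In the products over all i >= 1 the factors with i > sumn l are equal to 1,
   since no part of l exceeds sumn l. *)
Definition part_denom (l : seq nat) : nat :=
  \prod_(1 <= i < (sumn l).+1) (i`! ^ mult i l * (mult i l)`!).

(* The variables y_1, y_2, ... are entries of an arbitrary sequence in an
   arbitrary commutative Q-algebra A (for instance a polynomial algebra, the y_i
   being its indeterminates); the entry y 0 is never used. *)
Definition part_monomial (A : comAlgType rat) (y : nat -> A) (l : seq nat) : A :=
  \prod_(1 <= i < (sumn l).+1) y i ^+ mult i l.

Definition pbell (A : comAlgType rat) (n k : nat) (y : nat -> A) : A :=
  \sum_(l <- partitions n | size l == k)
     ((n`!)%:R / (part_denom l)%:R) *: part_monomial y l.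

Definition cbell (A : comAlgType rat) (n : nat) (y : nat -> A) : A :=
  \sum_(0 <= k < n.+1) pbell n k y.

Definition mpbell (A : comAlgType rat) (s n k r : nat) (y : nat -> A) : A :=
  \sum_(l <- partitions (n + r * s) |
          (size l == k) && (r <= size (parts_gt s l))%N)
     ((n`!)%:R * esym r (ffact_parts s (parts_gt s l)) / (part_denom l)%:R)
       *: part_monomial y l.

Definition mcbell (A : comAlgType rat) (s n : nat) (y : nat -> A) : A :=
  \sum_(0 <= r < n.+1) \sum_(r <= k < n.+1) mpbell s n k r y.

Definition shift_seq (A : Type) (s : nat) (y : nat -> A) : nat -> A :=
  fun i => y (s + i)%N.

(* Main.v *)
(* Summing over orderings of partitions turns B_{n,k}(y) into n!/k! times the
   coefficient of X^n in F^k, where F = \sum_i y_i X^i / i!.  Marking each part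
   a > s by the factor 1 + T (a)_s makes e_r the coefficient of T^r, and since
   (a)_s / a! = 1 / (a-s)! it replaces F by F + T X^s G, where G is the series F
   of the shifted sequence y_{s+i}.  The coefficient of T^r X^(n+rs) in
   (F + T X^s G)^k is 'C(k, r) times that of X^n in F^(k-r) G^r, and expanding
   this product gives the convolution. *)
Require Import Defs.
From mathcomp Require Import all_boot all_order all_algebra.
From mathcomp Require Import zify ring.
Import GRing.Theory.
Local Open Scope ring_scope.
Set Implicit Arguments.
Unset Strict Implicit.
Unset Printing Implicit Defensive.

(** * Multiplicities and orderings of a partition *)

Lemma part_bounds N l : is_part N l -> all (fun a => 0 < a <= N)%N l.
Proof.
move=> /and3P [_ l0 /eqP <-]; apply/allP => a al.
rewrite lt0n (memPn l0) //= sumnE (big_rem a al) leq_addr //.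
Qed.

Lemma prod_exp_mult (R : comPzSemiRingType) (f : nat -> R) M l :
  all (fun a => 0 < a <= M)%N l ->
  \prod_(1 <= i < M.+1) f i ^+ mult i l = \prod_(a <- l) f a.
Proof.
elim: l => [|a l IH] /=; first by rewrite big_nil big1.
move=> /andP [aM lM]; rewrite big_cons -IH //.
under eq_bigr do rewrite exprD.
rewrite big_split /= (bigD1_seq a) ?iota_uniq ?mem_index_iota //= eqxx expr1.
by rewrite big1 ?mulr1 // => i /negbTE ia; rewrite eq_sym ia.
Qed.

(** Group the orderings of [l] by their first entry [a]; what follows is an ordering of [rem a l].
    Removing [a] lowers only its own multiplicity, so induction gives [count_mem a l] times (size l
    - 1)! orderings up to the common product, and these multiplicities add up to [size l]. *)
Lemma size_permutations_mult M (l : seq nat) :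
  all (fun a => 0 < a <= M)%N l ->
  (size (permutations l) * \prod_(1 <= i < M.+1) (mult i l)`! = (size l)`!)%N.
Proof.
have [n] := ubnP (size l); elim: n l => // n IH l; rewrite ltnS => ln lM.
have [l0|l_gt0] := posnP (size l).
  by rewrite (size0nil l0) big1.
rewrite (perm_size (permutationsE l_gt0)) size_allpairs_dep sumnE big_map.
rewrite big_distrl /=.
rewrite (eq_big_seq (fun a => count_mem a l * (size l).-1`!)%N) => [|a].
  rewrite -big_distrl /= -(prednK l_gt0) factS (prednK l_gt0).
  congr (_ * _)%N; rewrite -[RHS]sum1_size -[RHS]big_undup_iterop_count.
  by apply: eq_bigr => a _; rewrite Monoid.iteropE iter_addn_0 mul1n.
rewrite mem_undup => al.
have aM := allP lM a al.
have remM : all (fun a => 0 < a <= M)%N (rem a l).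
  by apply/allP => b /mem_rem bl; apply: (allP lM).
rewrite -(size_rem al) -(IH (rem a l)) ?size_rem ?prednK //.
rewrite mulnCA; congr (_ * _)%N.
have perm_l := perm_to_rem al.
rewrite !(bigD1_seq a) ?iota_uniq ?mem_index_iota //= mulnA; congr (_ * _)%N.
  by rewrite /mult (permP perm_l) /= eqxx add1n factS.
by apply: eq_bigr => i ia; rewrite /mult (permP perm_l) /= eq_sym (negbTE ia).
Qed.

(** * Compositions and coefficients of powers of a series *)

Fixpoint compositions (N k : nat) : seq (seq nat) :=
  if k is k'.+1 then
    [seq a :: c | a <- index_iota 1 N.+1, c <- compositions (N - a) k']
  else if N == 0%N then [:: [::]] else [::].

Lemma mem_compositions N k c :
  (c \in compositions N k) = [&& size c == k, 0%N \notin c & sumn c == N].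
Proof.
elim: k N c => [|k IH] N c /=.
  by case: c => [|a c]; case: eqP => //= [->|/eqP N0]; rewrite // (eq_sym 0%N) (negbTE N0).
apply/allpairsPdep/idP => [[a [d [aN dN ->]]]|].
  move: aN dN; rewrite IH mem_index_iota inE negb_or /= eqSS (eq_sym 0%N) -lt0n.
  move=> /andP [-> aN] /and3P [-> -> /eqP ->] /=.
  by rewrite subnKC.
case: c => //= a c; rewrite eqSS inE negb_or (eq_sym 0%N) -lt0n.
move=> /and3P [ck /andP [a0 c0] /eqP cN]; exists a, c; split => //.
  by rewrite mem_index_iota a0 -cN ltnS leq_addr.
by rewrite IH ck c0 -cN addKn eqxx.
Qed.

Lemma uniq_compositions N k : uniq (compositions N k).
Proof.
elim: k N => [|k IH] N /=; first by case: eqP.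
apply: allpairs_uniq_dep; rewrite ?iota_uniq // => -[a c] [b d] _ _ /= [].
by move=> -> ->.
Qed.

(** Every composition is a rearrangement of exactly one partition, its weakly decreasing sort, and
    [F] is constant on rearrangements. *)
Lemma big_compositions (R : nmodType) (F : seq nat -> R) N k :
  (forall c d, perm_eq c d -> F c = F d) ->
  \sum_(c <- compositions N k) F c =
  \sum_(l <- partitions N | size l == k) F l *+ size (permutations l).
Proof.
move=> Fperm; have geq_anti : antisymmetric geq.
  by move=> a b /=; rewrite -eqn_leq => /eqP ->.
have geq_trans : transitive geq by move=> b a c /= ba cb; apply: leq_trans ba.
have geq_total : total geq by move=> a b; apply: leq_total.
rewrite (perm_big (flatten [seq permutations l | l <- partitions N & size l == k])).
  rewrite big_flatten big_map big_filter; apply: eq_bigr => l _.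
  rewrite -iter_addr_0 -[size _]count_predT -big_const_seq; apply: eq_big_seq => c.
  by rewrite mem_permutations; apply: Fperm.
apply: uniq_perm => [||c]; first exact: uniq_compositions.
  have : all (sorted geq) [seq l <- partitions N | size l == k].
    by apply/allP => l; rewrite mem_filter mem_partitions => /andP [_ /and3P []].
  have := filter_uniq (fun l => size l == k) (uniq_partitions N).
  elim: [seq _ <- _ | _] => //= l ls IH /andP [l_ls ls_uniq] /andP [lS lsS].
  rewrite cat_uniq permutations_uniq IH // andbT.
  apply/hasPn => c /flatten_mapP [m m_ls]; rewrite !mem_permutations /= => cm.
  apply: contra l_ls => cl; rewrite (sorted_eq geq_trans geq_anti lS (allP lsS m m_ls)) //.
  by rewrite -(permPl cl).
rewrite mem_compositions; apply/idP/flatten_mapP => [/and3P [ck c0 cN]|].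
  exists (sort geq c); last by rewrite mem_permutations perm_sym perm_sort.
  rewrite mem_filter size_sort ck mem_partitions /is_part sort_sorted //.
  by rewrite mem_sort c0 (perm_sumn (permEl (perm_sort _ _))) cN.
move=> [l]; rewrite mem_filter mem_partitions => /andP [lk /and3P [_ l0 lN]].
rewrite mem_permutations => cl.
by rewrite (perm_size cl) lk (perm_mem cl) l0 (perm_sumn cl).
Qed.

(* With w = divided y, this is the series F of the header, truncated at degree M. *)
Definition egf (R : nzRingType) (M : nat) (w : nat -> R) : {poly R} :=
  \poly_(i < M.+1) (if i == 0%N then 0 else w i).

(** Splitting off one factor and summing over the degree [j] taken from it reproduces the recursion
    of [compositions] on the first part. The term [j = 0] drops out because the constant term is 0,
    and [N <= M] keeps the truncation from being seen. *)
Lemma coef_egf_exp (R : comNzRingType) M N k (w : nat -> R) :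
  (N <= M)%N ->
  (egf M w ^+ k)`_N = \sum_(c <- compositions N k) \prod_(a <- c) w a.
Proof.
elim: k N => [|k IH] N NM.
  rewrite expr0 coef1 /=; case: eqP => _; rewrite ?big_nil //.
  by rewrite big_seq1 big_nil.
rewrite exprS coefM -(big_mkord xpredT (fun j => (egf M w)`_j * (egf M w ^+ k)`_(N - j))).
rewrite big_allpairs_dep big_ltn // coef_poly /= mul0r add0r.
apply: eq_big_nat => j /andP [j0 jN].
rewrite coef_poly ltnS (leq_trans _ NM) // (gtn_eqF j0) IH ?(leq_trans (leq_subr _ _)) //.
by rewrite big_distrr; apply: eq_bigr => c _; rewrite big_cons.
Qed.

Lemma coef_egf_exp_partitions (R : comNzRingType) M N k (w : nat -> R) :
  (N <= M)%N ->
  (egf M w ^+ k)`_N =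
  \sum_(l <- partitions N | size l == k)
     (\prod_(a <- l) w a) *+ size (permutations l).
Proof.
move=> NM; rewrite coef_egf_exp //.
by apply: (@big_compositions _ (fun c => \prod_(a <- c) w a)) => c d; apply: perm_big.
Qed.

(** * From partition weights to coefficients *)

Lemma fact_neq0 n : (n`!)%:R != 0 :> rat.
Proof. by rewrite Num.Theory.pnatr_eq0 -lt0n fact_gt0. Qed.

(** The multinomial count of orderings absorbs the factors m_i!, leaving (size l)! and one factorial
    per part. *)
Lemma natr_part_denom N l : is_part N l ->
  (part_denom l)%:R * (size (permutations l))%:R
    = (size l)`!%:R * \prod_(a <- l) (a`!)%:R :> rat.
Proof.
move=> lN; have lM := part_bounds lN.
have /and3P [_ _ /eqP sumE] := lN.
rewrite -(size_permutations_mult lM) /part_denom sumE big_split !natrM /=.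
rewrite natr_prod (eq_bigr (fun i => (i`!)%:R ^+ mult i l)) => [|i _]; last first.
  by rewrite natrX.
rewrite (prod_exp_mult (fun a => (a`!)%:R)) // -mulrA mulrC.
by congr (_ * _); rewrite mulrC.
Qed.

Definition divided (A : comAlgType rat) (y : nat -> A) (i : nat) : A :=
  (i`!)%:R^-1 *: y i.

(** The scalar [c] is 1 for the ordinary polynomials and a value of e_r for the modified ones. *)
Lemma part_term (A : comAlgType rat) (y : nat -> A) n N l (c : rat) :
  is_part N l ->
  (n`!%:R * c / (part_denom l)%:R) *: part_monomial y l =
  (n`!%:R / (size l)`!%:R) *:
     ((c *: \prod_(a <- l) divided y a) *+ size (permutations l)).
Proof.
move=> lN; have /and3P [_ _ /eqP sumE] := lN.
rewrite /part_monomial sumE (prod_exp_mult _ (part_bounds lN)).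
rewrite scaler_prod -scaler_nat !scalerA; congr (_ *: _).
have facts_neq0 : \prod_(a <- l) (a`!)%:R != 0 :> rat.
  by rewrite prodf_seq_neq0; apply/allP => a _; rewrite fact_neq0.
have := natr_part_denom lN.
have denom_neq0 : (part_denom l)%:R != 0 :> rat.
  rewrite Num.Theory.pnatr_eq0 -lt0n prodn_gt0 // => i.
  by rewrite muln_gt0 expn_gt0 !fact_gt0.
rewrite prodfV => E.
apply: (mulIf denom_neq0); rewrite mulfVK //.
rewrite -!mulrA (mulrCA _ c); congr (_ * _).
rewrite mulrCA; apply: (mulfI (fact_neq0 (size l))).
rewrite mulrCA mulVKf ?fact_neq0 //.
apply: (mulIf facts_neq0).
rewrite [_^-1 * _]mulrC (mulrA _%:R (part_denom l)%:R) (mulrA c) mulfVK //.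
by rewrite [X in _ = c * X]mulrC E mulrCA mulrA.
Qed.

Lemma pbellE (A : comAlgType rat) (y : nat -> A) M n k :
  (n <= M)%N ->
  pbell n k y = (n`!%:R / k`!%:R) *: (egf M (divided y) ^+ k)`_n.
Proof.
move=> nM; rewrite coef_egf_exp_partitions // scaler_sumr.
rewrite /pbell big_seq_cond [RHS]big_seq_cond.
apply: eq_bigr => l /andP []; rewrite mem_partitions => lN /eqP <-.
by rewrite -[X in X / _]mulr1 (part_term _ _ _ lN) scale1r.
Qed.

(** * Marking the parts greater than s *)

Lemma coef_prod_esym (A : comAlgType rat) l r :
  (\prod_(b <- l) (1 + 'X *+ b) : {poly A})`_r = (Defs.esym r l)%:A.
Proof.
rewrite big_tnth; under eq_bigr do rewrite addrC.
(* Each set [J] of positions contributes 'X^#|J| times the product of the entries at [J]. *)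
rewrite bigA_distr coef_sum /Defs.esym /mesym rmorph_sum scaler_suml [RHS]big_mkcond /=.
apply: eq_bigr => J _; rewrite -big_mkcond.
rewrite prodrMn prodr_const coefMn coefXn rmorph_prod /=.
under [X in X *: _]eq_bigr do rewrite mevalXU.
rewrite -natr_prod eq_sym; case: eqP => _; last by rewrite mul0rn.
by rewrite scaler_nat.
Qed.

(* Here 'X is the marker T of the header, not the variable of egf. *)
Definition marked (A : comAlgType rat) (s : nat) (y : nat -> A) (a : nat) :
  {poly A} :=
  (divided y a)%:P * (if (s < a)%N then 1 + 'X *+ (a ^_ s) else 1).

Lemma coef_prod_marked (A : comAlgType rat) (y : nat -> A) s l r :
  (\prod_(a <- l) marked s y a)`_r =
  Defs.esym r (ffact_parts s (parts_gt s l)) *: \prod_(a <- l) divided y a.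
Proof.
rewrite big_split -rmorph_prod /= coefCM -big_mkcond mulrC.
have <- : \prod_(b <- ffact_parts s (parts_gt s l)) (1 + 'X *+ b) =
          \prod_(a <- l | (s < a)%N) (1 + 'X *+ (a ^_ s)) :> {poly A}.
  by rewrite big_map big_filter.
by rewrite coef_prod_esym mulr_algl.
Qed.

Lemma mpbellE (A : comAlgType rat) (y : nat -> A) M s n k r :
  (n + r * s <= M)%N ->
  mpbell s n k r y =
  (n`!%:R / k`!%:R) *: ((egf M (marked s y) ^+ k)`_(n + r * s))`_r.
Proof.
move=> nM; rewrite coef_egf_exp_partitions // coef_sum scaler_sumr.
rewrite /mpbell big_mkcondr big_seq_cond [RHS]big_seq_cond.
apply: eq_bigr => l /andP []; rewrite mem_partitions => lN /eqP <-.
rewrite coefMn coef_prod_marked -(part_term _ _ _ lN).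
(* The restriction on the number of parts exceeding [s] costs nothing: with fewer than [r] of them,
   e_r is 0. *)
case: leqP => // r_gt; rewrite /Defs.esym mesym_geqnE ?size_map //.
by rewrite meval0 mulr0 mul0r scale0r.
Qed.

(** The truncation degrees differ by [s] so that the identity is exact: X^s times a series cut at
    [M] is cut at [M + s]. *)
Lemma egf_marked (A : comAlgType rat) (y : nat -> A) M s :
  egf (M + s) (marked s y) =
  map_poly polyC (egf (M + s) (divided y)) +
  'X%:P * map_poly polyC (egf M (divided (shift_seq s y)) * 'X^s).
Proof.
apply/polyP => i; rewrite coefD coefCM !coef_map coefMXn !coef_poly /=.
case: ltnP => iM; last first.
  rewrite ltnS leq_subLR addnC (leqNgt i) iM /=.
  by case: ifP; rewrite mulr0 addr0.
have [->|i0] := eqVneq i 0%N; first by rewrite sub0n eqxx; case: ifP; rewrite mulr0 addr0.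
rewrite /marked; have [si|si|<-] := ltngtP s i; first last.
(* At i = s the shifted series contributes its zero constant term, in agreement with the strict
   [s < a] in [marked]. *)
- by rewrite subnn eqxx mulr0 addr0 mulr1.
- by rewrite mulr0 addr0 mulr1.
rewrite ltnS leq_subLR addnC -ltnS iM subn_eq0 leqNgt si /= mulrDr mulr1.
congr (_ + _); rewrite /divided /shift_seq subnKC 1?ltnW //.
rewrite mulrnAr (mulrC _ 'X) -mulrnAr -polyCMn; congr (_ * _%:P).
rewrite -scaler_nat scalerA; congr (_ *: _).
rewrite -(ffact_fact (ltnW si)) natrM invfM mulVKf //.
by rewrite Num.Theory.pnatr_eq0 -lt0n ffact_gt0 ltnW.
Qed.

(** In the binomial expansion the summand of index [j] is T^j times a series with coefficients
    constant in T, so only [j = r] survives. Its factor X^(rs) lowers the degree from n + rs to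
    n. *)
Lemma coef_egf_marked_exp (A : comAlgType rat) (y : nat -> A) M s n k r :
  (r <= k)%N ->
  ((egf (M + s) (marked s y) ^+ k)`_(n + r * s))`_r =
  (egf (M + s) (divided y) ^+ (k - r) *
   egf M (divided (shift_seq s y)) ^+ r)`_n *+ 'C(k, r).
Proof.
move=> rk; rewrite egf_marked exprDn coef_sum coef_sum.
rewrite (bigD1 (Ordinal (rk : (r < k.+1)%N))) //= big1 ?addr0 => [|j jr].
  rewrite exprMn -!rmorphXn mulrCA coefMn coefCM -rmorphM /= coef_map /=.
  rewrite coefMn coefXnM ltnn subnn coefC /=.
  rewrite exprMn mulrA -exprM mulnC coefMXn ltnNge leq_addl /= addnK //.
rewrite exprMn -!rmorphXn mulrCA coefMn coefCM -rmorphM /= coef_map /=.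
rewrite coefMn coefXnM coefC subn_eq0.
have [rj|jr'|rj] := ltngtP r j; rewrite ?mul0rn //=.
by case/eqP: jr; apply: val_inj.
Qed.

(** * The convolution formulas *)

Lemma pbell_gt (A : comAlgType rat) (y : nat -> A) n k : (n < k)%N -> pbell n k y = 0.
Proof.
move=> nk; rewrite /pbell big_seq_cond big1 // => l /andP [].
rewrite mem_partitions => /and3P [_ l0 /eqP lN] /eqP lk.
suff : (size l <= n)%N by rewrite lk leqNgt nk.
rewrite -lN -sum1_size sumnE; rewrite [X in (X <= _)%N]big_seq [X in (_ <= X)%N]big_seq.
by apply: leq_sum => a al; rewrite lt0n (memPn l0).
Qed.

(** The range of [p] is independent of [k] and [r], so that sums can later be exchanged; outside r
    <= p <= n - k + r one of the two factors vanishes by [pbell_gt]. *)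
Lemma mpbell_convolution (A : comAlgType rat) (y : nat -> A) s n k r :
  (r <= k)%N ->
  mpbell s n k r y =
  \sum_(0 <= p < n.+1)
     (pbell (n - p) (k - r) y * pbell p r (shift_seq s y)) *+ 'C(n, p).
Proof.
(* The degree has the form [M + s] with M = n + rs, as [coef_egf_marked_exp] requires. *)
move=> rk; rewrite (@mpbellE _ _ (n + r * s + s)) ?leq_addr //.
rewrite coef_egf_marked_exp // coefMr big_mkord -sumrMnl scaler_sumr.
apply: eq_bigr => p _; have pn : (p <= n)%N by rewrite -ltnS.
rewrite (@pbellE _ y (n + r * s + s)); last first.
  by rewrite (leq_trans (leq_subr _ _)) // -addnA leq_addr.
rewrite (@pbellE _ (shift_seq s y) (n + r * s)); last first.
  by rewrite (leq_trans pn) ?leq_addr.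
rewrite -scalerAl -scalerAr -!scaler_nat !scalerA; congr (_ *: _).
(* Both scalars equal n! / (r! (k - r)!). *)
rewrite -(bin_fact rk) -(bin_fact pn) !natrM !invfM.
have C_neq0 : 'C(k, r)%:R != 0 :> rat.
  by rewrite Num.Theory.pnatr_eq0 -lt0n bin_gt0.
by move: (fact_neq0 r) (fact_neq0 (k - r)) => r_neq0 kr_neq0; field; apply/and3P.
Qed.

Lemma cbell_widen (A : comAlgType rat) (y : nat -> A) m n : (m <= n)%N ->
  cbell m y = \sum_(0 <= k < n.+1) pbell m k y.
Proof.
move=> mn; rewrite (@big_cat_nat _ _ _ m.+1) //= [X in _ + X]big_nat.
by rewrite [X in _ + X]big1 ?addr0 // => k /andP [mk _]; apply: pbell_gt.
Qed.

Theorem proposition14 (A : comAlgType rat) (y : nat -> A) (s : nat) :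
  (forall n k r : nat, (r <= k)%N -> (k <= n)%N ->
     mpbell s n k r y =
     \sum_(r <= p < (n - k + r).+1)
        (pbell (n - p) (k - r) y * pbell p r (shift_seq s y)) *+ 'C(n, p))
  /\
  (forall n : nat,
     mcbell s n y =
     \sum_(0 <= p < n.+1)
        (cbell (n - p) y * cbell p (shift_seq s y)) *+ 'C(n, p)).
Proof.
split=> [n k r rk kn|n].
  have nkr : (n - k + r <= n)%N by rewrite -[leqRHS](subnK kn) leq_add2l.
  have rn : (r <= n.+1)%N by rewrite leqW // (leq_trans rk).
  rewrite mpbell_convolution // (@big_cat_nat _ _ _ r) //=.
  rewrite big_nat big1 ?add0r => [|p /andP [_ pr]]; last first.
    by rewrite (pbell_gt _ pr) mulr0 mul0rn.
  rewrite (@big_cat_nat _ _ _ (n - k + r).+1) ?(leqW (leq_addl _ _)) //=.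
  rewrite [X in _ + X]big_nat [X in _ + X]big1 ?addr0 // => p /andP [kp pn].
  rewrite pbell_gt ?mul0r ?mul0rn //; lia.
(* Here [j] stands for k - r; letting it run up to [n] for every [r] makes the triple sum
   rectangular. *)
pose T r j p := (pbell (n - p) j y * pbell p r (shift_seq s y)) *+ 'C(n, p).
transitivity (\sum_(0 <= r < n.+1) \sum_(0 <= j < n.+1) \sum_(0 <= p < n.+1) T r j p).
  apply: eq_big_nat => r /andP [_ rn].
  rewrite -[X in \sum_(X <= _ < _) _]add0n big_addn.
  rewrite [RHS](@big_cat_nat _ _ _ (n.+1 - r)) ?leq_subr //=.
  rewrite [X in _ + X]big_nat [X in _ + X]big1 ?addr0 => [|j /andP [jr jn]].
    by apply: eq_bigr => j _; rewrite mpbell_convolution ?leq_addl // addnK.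
  (* The added terms have j + r > n, hence p < r or n - p < j. *)
  rewrite big_nat big1 // => p /andP [_ pn]; rewrite /T.
  have [pr|rp] := ltnP p r; first by rewrite (pbell_gt _ pr) mulr0 mul0rn.
  by rewrite (@pbell_gt _ y) ?mul0r ?mul0rn //; lia.
(* With [p] outermost, the double sum over [r] and [j] factors into two complete polynomials, once
   their ranges are widened to [n]. *)
rewrite exchange_big; under eq_bigr do rewrite exchange_big.
rewrite exchange_big; apply: eq_big_nat => p /andP [_ pn].
rewrite (cbell_widen _ (leq_subr p n)) (@cbell_widen _ _ p n) //.
by rewrite big_distrlr -sumrMnl; under [RHS]eq_bigr do rewrite -sumrMnl.
Qed.
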